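(* Let $(r_k)_{k\ge 1}$, $(s_k)_{k\ge 0}$, $(t_k)_{k\ge 1}$ be sequences of nonnegative real numbers, and let $A=[a_{n,k}]_{n,k\ge 0}$ be the infinite lower triangular matrix with $a_{n,k}=0$ unless $n\ge k\ge 0$, defined by $$a_{0,0}=1,\quad a_{n+1,0}=s_0a_{n,0}+t_1a_{n,1},\quad a_{n+1,k}=r_{k}a_{n,k-1}+s_ka_{n,k}+t_{k+1}a_{n,k+1}\quad (k\ge 1,\ n\ge 0).$$ (i) If $s_0\ge r_1$ and $s_k\ge r_{k+1}+t_{k}$ for all $k\ge 1$, then $A$ is TP. (ii) If $s_0\ge t_1$ and $s_k\ge r_k+t_{k+1}$ for all $k\ge 1$, then $A$ is TP.
   Context: A real (finite or infinite) matrix is TP (totally positive) if its minors of all orders are nonnegative. *)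

(* Defs.v *)
From mathcomp Require Import all_boot all_order all_algebra.
From mathcomp Require Import reals.

Set Implicit Arguments.
Unset Strict Implicit.
Unset Printing Implicit Defensive.

Import Order.TTheory GRing.Theory Num.Theory.
Local Open Scope ring_scope.

(* An infinite matrix is a function [nat -> nat -> R]; a minor of order m is
   given by strictly increasing choices of m rows and m columns. *)
Definition minor (R : realType) (A : nat -> nat -> R) (m : nat)
    (row col : 'I_m -> nat) : R :=
  \det (\matrix_(i < m, j < m) A (row i) (col j)).

Definition totally_positive (R : realType) (A : nat -> nat -> R) : Prop :=
  forall (m : nat) (row col : 'I_m -> nat),
    {homo row : i j / (i < j)%N} -> {homo col : i j / (i < j)%N} ->
    0 <= minor A row col.

(* The values [r 0] and [t 0] are never used: r and t are indexed from 1. *)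
Fixpoint recursive_mx (R : realType) (r s t : nat -> R) (n k : nat) : R :=
  match n, k with
  | 0%N, 0%N => 1
  | 0%N, _.+1 => 0
  | n'.+1, 0%N =>
      s 0%N * recursive_mx r s t n' 0%N + t 1%N * recursive_mx r s t n' 1%N
  | n'.+1, k'.+1 =>
      r k * recursive_mx r s t n' k' + s k * recursive_mx r s t n' k
      + t k.+1 * recursive_mx r s t n' k.+1
  end.

Lemma recursive_mx_lower (R : realType) (r s t : nat -> R) (n k : nat) :
  (n < k)%N -> recursive_mx r s t n k = 0.
Proof.
elim: n k => [|n IHn] [|k] //= lt_nk.
by rewrite !IHn ?mulr0 ?addr0 // ?(leqW lt_nk) // ltnW // ltnW.
Qed.

(* Main.v *)
Require Import Defs.
From mathcomp Require Import all_boot all_order all_algebra.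
From mathcomp Require Import reals.
From mathcomp Require Import ring.

Set Implicit Arguments.
Unset Strict Implicit.
Unset Printing Implicit Defensive.

Import Order.TTheory GRing.Theory Num.Theory.
Local Open Scope ring_scope.

(** Row [n.+1] of the matrix is row [n] times the tridiagonal matrix [J] with
    superdiagonal [r], diagonal [s] and subdiagonal [t]; row [0] is the first
    unit vector.

    If [J = L U] with [L] lower bidiagonal, [U] upper bidiagonal and all entries
    nonnegative, the matrix is totally positive.  Indeed, each column of [X L]
    or of [X U] is a nonnegative combination of two adjacent columns of [X], so
    by multilinearity a minor of the product is a nonnegative combination of
    minors of [X] whose column indices are still weakly increasing; these vanish
    if an index is repeated, and are minors of [X] proper otherwise
    ([col_nonneg_combination]).  Minors avoiding row [0] thus reduce to minors
    on earlier rows, while row [0] can be removed by Laplace expansion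
    ([tp_of_bidiagonal_factors]).

    Such a factorization is given by Gaussian elimination.  The pivots are
    [d 0 = s 0] and [d k.+1 = s k.+1 - r k.+1 * t k.+1 / d k].  Under the
    hypotheses of the first part, [r k.+1 <= d k] for all [k] by induction
    ([pivot_ge]), so one may take [L] with diagonal [d] and subdiagonal [t], and
    [U] with unit diagonal and superdiagonal [r k.+1 / d k].  A vanishing pivot
    is harmless: it forces [r k.+1 = 0], so that the convention [x / 0 = 0]
    yields a correct factorization.  The second part exchanges [r] and [t]: the
    unit diagonal is then that of [L]. *)

(** * Minors of a family of rows *)

(** All maximal minors of the finite family of infinite rows [X], for strictly
    increasing choices of columns, are nonnegative. *)
Definition nonneg_col_minors (R : numDomainType) (m : nat)
    (X : 'I_m -> nat -> R) : Prop :=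
  forall col : 'I_m -> nat, {homo col : i j / (i < j)%N} ->
    0 <= \det (\matrix_(i < m, j < m) X i (col j)).

Lemma nonneg_col_minors_weak (R : numDomainType) (m : nat)
    (X : 'I_m -> nat -> R) (col : 'I_m -> nat) :
  nonneg_col_minors X -> {homo col : i j / (i < j)%N >-> (i <= j)%N} ->
  0 <= \det (\matrix_(i < m, j < m) X i (col j)).
Proof.
move=> X_ge0 col_homo; have [/injectiveP col_inj|] := boolP (injectiveb col).
  apply: X_ge0 => i j lt_ij; rewrite ltn_neqAle col_homo // andbT.
  by apply: contraTneq lt_ij => /col_inj ->; rewrite ltnn.
case/injectivePn=> i [j neq_ij eq_col].
rewrite -det_tr (determinant_alternate neq_ij) // => k.
by rewrite !mxE eq_col.
Qed.

(** Column [k] of the new family is a nonnegative combination of the columns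
    [f k] and [g k] of [X].  The hypothesis on [f] and [g] says that replacing
    each index [k] of an increasing sequence by [f k] or by [g k],
    independently, gives a weakly increasing sequence. *)
Lemma col_nonneg_combination (R : numDomainType) (m : nat)
    (X : 'I_m -> nat -> R) (f g : nat -> nat) (a b : nat -> R) :
  (forall k, 0 <= a k) -> (forall k, 0 <= b k) ->
  (forall j k, (j < k)%N -> (maxn (f j) (g j) <= minn (f k) (g k))%N) ->
  nonneg_col_minors X ->
  nonneg_col_minors (fun i k => a k * X i (f k) + b k * X i (g k)).
Proof.
move=> a_ge0 b_ge0 fg_homo X_ge0 col col_homo.
set Y := fun (i : 'I_m) k => a k * X i (f k) + b k * X i (g k).
(* The columns are expanded one at a time: those of rank less than [n] are still
   columns of [Y], and the others are columns of [X] with indices [h].  The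
   matrix is transposed, as multilinearity is stated for rows. *)
pose mixed n (h : 'I_m -> nat) : 'M[R]_m := \matrix_(j, i)
  if (j < n)%N then Y i (col j) else X i (h j).
have mixed_ge0 n : (n <= m)%N -> forall h : 'I_m -> nat,
    (forall j, (h j == f (col j)) || (h j == g (col j))) ->
  0 <= \det (mixed n h).
  elim: n => [_|n IHn lt_nm] h h_fg.
    rewrite -det_tr (_ : _^T = \matrix_(i, j) X i (h j)); last first.
      by apply/matrixP=> i j; rewrite !mxE.
    apply: nonneg_col_minors_weak => // i j /col_homo /fg_homo.
    rewrite geq_max !leq_min => /andP[/andP[ff fg] /andP[gf gg]].
    by case/orP: (h_fg i) => /eqP ->; case/orP: (h_fg j) => /eqP ->.
  pose o := Ordinal lt_nm; pose upd x j := if j == o then x else h j.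
  have row'_upd x : row' o (mixed n (upd x)) = row' o (mixed n.+1 h).
    apply/matrixP=> j i; rewrite !mxE /upd ltnS (leq_eqVlt (lift o j)).
    have neq_jo : lift o j != o by rewrite eq_sym neq_lift.
    rewrite (negPf neq_jo) -[lift o j == n :> nat]/(lift o j == o).
    by rewrite (negPf neq_jo).
  have upd_ge0 x : (x == f (col o)) || (x == g (col o)) ->
      0 <= \det (mixed n (upd x)).
    move=> x_fg; apply: IHn => [|j]; first exact: ltnW.
    by rewrite /upd; case: (eqVneq j o) => [->|].
  have row_mixed : row o (mixed n.+1 h) =
      a (col o) *: row o (mixed n (upd (f (col o)))) +
      b (col o) *: row o (mixed n (upd (g (col o)))).
    by apply/rowP=> i; rewrite !mxE ltnSn ltnn /upd eqxx.
  rewrite (determinant_multilinear row_mixed) ?row'_upd //.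
  by apply: addr_ge0; apply: mulr_ge0; rewrite ?upd_ge0 ?eqxx ?orbT.
have := mixed_ge0 m (leqnn m) (f \o col)
  (fun=> introT orP (or_introl (eqxx _))).
rewrite -det_tr; congr (0 <= \det _).
by apply/matrixP=> i j; rewrite !mxE ltn_ord.
Qed.

(** * From a bidiagonal factorization to total positivity *)

(** The factors are [L], with diagonal [p] and subdiagonal [q], and [U], with
    diagonal [u] and superdiagonal [v]; like [r] and [t], the sequences [q] and
    [v] are indexed from 1. *)
Lemma tp_of_bidiagonal_factors (R : realType) (r s t p q u v : nat -> R) :
  (forall k, 0 <= p k) -> (forall k, 0 <= q k.+1) ->
  (forall k, 0 <= u k) -> (forall k, 0 <= v k.+1) ->
  (forall k, p k * v k.+1 = r k.+1) ->
  (forall k, q k.+1 * u k = t k.+1) ->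
  p 0%N * u 0%N = s 0%N ->
  (forall k, p k.+1 * u k.+1 + q k.+1 * v k.+1 = s k.+1) ->
  totally_positive (recursive_mx r s t).
Proof.
move=> p_ge0 q_ge0 u_ge0 v_ge0 rE tE s0E sE.
set A := recursive_mx r s t.
suff rows_lt N m (row : 'I_m -> nat) : {homo row : i j / (i < j)%N} ->
    (forall i, (row i < N)%N) -> nonneg_col_minors (fun i => A (row i)).
  move=> m row col row_homo col_homo.
  by apply: (rows_lt (\max_i row i).+1) => // i; rewrite ltnS leq_bigmax.
elim: N m row => [|N IHN] m row row_homo row_lt.
  by case: m row row_homo row_lt => [|m] row _ row_lt col _;
     [rewrite det_mx00 | have := row_lt ord0].
have rows_pos m' (row' : 'I_m' -> nat) : {homo row' : i j / (i < j)%N} ->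
    (forall i, 0 < row' i < N.+1)%N -> nonneg_col_minors (fun i => A (row' i)).
  move=> row'_homo row'_lt.
  have A_ge0 : nonneg_col_minors (fun i => A (row' i).-1).
    apply: IHN => [i j /row'_homo|i]; have /andP[] := row'_lt i.
      by case: (row' i) (row' j) => [|x] [|y].
    by case: (row' i).
  (* Multiply on the right by [L], then by [U]; the column of [U] of index 0 has
     a single entry, whence the null coefficient of the dummy index [0.-1]. *)
  have AL_ge0 : nonneg_col_minors
      (fun i k => p k * A (row' i).-1 k + q k.+1 * A (row' i).-1 k.+1).
    apply: (col_nonneg_combination (f := id) (g := succn) p_ge0 q_ge0 _ A_ge0).
    by move=> j k lt_jk; rewrite (maxn_idPr (leqnSn j)) (minn_idPl (leqnSn k)).
  move=> col col_homo.
  have -> : \matrix_(i, j) A (row' i) (col j) = \matrix_(i, j)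
      (let k := col j in
       let Y k := p k * A (row' i).-1 k + q k.+1 * A (row' i).-1 k.+1 in
       u k * Y k + (if k is k'.+1 then v k else 0) * Y k.-1).
    apply/matrixP=> i j; rewrite !mxE /=.
    have /andP[] := row'_lt i; case: (row' i) => // n _ _.
    rewrite /A; case: (col j) => [|k] /=.
      by rewrite -s0E -tE; ring.
    by rewrite -rE -sE -tE; ring.
  apply: (col_nonneg_combination (f := id) (g := predn)
            (b := fun k => if k is k'.+1 then v k else 0)
            u_ge0 _ _ AL_ge0) => //.
    by case.
  move=> j [|k] // le_jk.
  by rewrite (maxn_idPl (leq_pred j)) (minn_idPr (leq_pred k.+1)).
case: m row row_homo row_lt => [|m] row row_homo row_lt col col_homo.
  by rewrite det_mx00.
have row_ge i : (row ord0 <= row i)%N.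
  have [->|i_neq0] := eqVneq i ord0; first exact: leqnn.
  by apply/ltnW/row_homo; rewrite lt0n.
have [row0|row0_gt0] := posnP (row ord0); last first.
  by apply: rows_pos => // i; rewrite row_lt (leq_trans row0_gt0).
(* Row 0 of [A] is the first unit vector, so at most one term survives: the one
   for the first chosen column, the only one whose index can be 0. *)
rewrite (expand_det_row _ ord0) big_ord_recl big1 ?addr0 => [|j _]; last first.
  rewrite mxE row0.
  have : (0 < col (lift ord0 j))%N by apply: leq_ltn_trans (col_homo ord0 _ _).
  by case: (col _) => // k _; rewrite mul0r.
rewrite mxE row0 /cofactor expr0 mul1r mulr_ge0 //.
  by case: (col ord0) => [|k]; rewrite /A /= ?ler01.
rewrite (_ : row' _ _ =
    \matrix_(i, j) A (row (lift ord0 i)) (col (lift ord0 j))).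
  apply: (rows_pos _ (row \o lift ord0)) => [i j lt_ij|i|i j lt_ij].
  - exact: row_homo.
  - by rewrite row_lt andbT -row0 row_homo.
  - exact: col_homo.
by apply/matrixP=> i j; rewrite !mxE.
Qed.

(** * Pivots of a diagonally dominant tridiagonal matrix *)

(** The diagonal entries produced by Gaussian elimination, without pivoting, on
    the tridiagonal matrix with superdiagonal [r], diagonal [s] and subdiagonal
    [t]. *)
Fixpoint pivot (R : fieldType) (r s t : nat -> R) (k : nat) : R :=
  if k is k'.+1 then s k - r k * t k / pivot r s t k' else s 0%N.

Section PivotBounds.

Variables (R : realFieldType) (r s t : nat -> R).
Hypothesis r_ge0 : forall k, 0 <= r k.+1.
Hypothesis t_ge0 : forall k, 0 <= t k.+1.
Hypothesis s0_dom : r 1%N <= s 0%N.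
Hypothesis s_dom : forall k, r k.+2 + t k.+1 <= s k.+1.

Lemma pivot_ge k : r k.+1 <= pivot r s t k.
Proof.
elim: k => //= k IHk; rewrite lerBrDr (le_trans _ (s_dom k)) // lerD2l.
have [->|d_neq0] := eqVneq (pivot r s t k) 0; first by rewrite invr0 mulr0.
have d_gt0 : 0 < pivot r s t k by rewrite lt0r d_neq0 (le_trans (r_ge0 k)).
by rewrite ler_pdivrMr // mulrC ler_wpM2l.
Qed.

Lemma pivot_ge0 k : 0 <= pivot r s t k.
Proof. exact: le_trans (r_ge0 k) (pivot_ge k). Qed.

(** This holds even for a null pivot, since [r k.+1] is then null as well. *)
Lemma pivot_mulKr k : pivot r s t k * (r k.+1 / pivot r s t k) = r k.+1.
Proof.
have [d0|d_neq0] := eqVneq (pivot r s t k) 0; last by rewrite mulrC divfK.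
by apply/eqP; rewrite d0 mul0r eq_le r_ge0 -d0 pivot_ge.
Qed.

End PivotBounds.

Theorem theorem2p8 (R : realType) (r s t : nat -> R)
  (r_ge0 : forall k : nat, (1 <= k)%N -> 0 <= r k)
  (s_ge0 : forall k : nat, 0 <= s k)
  (t_ge0 : forall k : nat, (1 <= k)%N -> 0 <= t k) :
  (s 0%N >= r 1%N ->
   (forall k : nat, (1 <= k)%N -> s k >= r k.+1 + t k) ->
   totally_positive (recursive_mx r s t)) /\
  (s 0%N >= t 1%N ->
   (forall k : nat, (1 <= k)%N -> s k >= r k + t k.+1) ->
   totally_positive (recursive_mx r s t)).
Proof.
have r_ge0' k : 0 <= r k.+1 by exact: r_ge0.
have t_ge0' k : 0 <= t k.+1 by exact: t_ge0.
split=> s0_dom s_dom.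
  have s_dom' k : r k.+2 + t k.+1 <= s k.+1 by exact: s_dom.
  have d_ge0 := pivot_ge0 r_ge0' t_ge0' s0_dom s_dom'.
  apply: (@tp_of_bidiagonal_factors _ _ _ _ (pivot r s t) t
           (fun=> 1) (fun k => r k / pivot r s t k.-1)) => //= [k|k|k||k].
  - by rewrite divr_ge0.
  - exact: pivot_mulKr.
  - by rewrite mulr1.
  - by rewrite mulr1.
  - by ring.
have s_dom' k : t k.+2 + r k.+1 <= s k.+1 by rewrite addrC s_dom.
have d_ge0 := pivot_ge0 t_ge0' r_ge0' s0_dom s_dom'.
apply: (@tp_of_bidiagonal_factors _ _ _ _ (fun=> 1)
         (fun k => t k / pivot t s r k.-1) (pivot t s r) r) => //= [k|k|k||k].
- by rewrite divr_ge0.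
- by rewrite mul1r.
- by rewrite mulrC pivot_mulKr.
- by rewrite mul1r.
- by ring.
Qed.
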